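(* Let $\Lambda_b\subseteq\mathbb{R}^n$ be a lattice and let $\gamma_b>0$. The decoding error probability $P_{e,b}$ of the legitimate receiver B in a Rayleigh fading wiretap channel with lattice coding or lattice coset coding (as described in the context) satisfies $$P_{e,b}\leq \frac{1}{2}\left(\frac{1}{\operatorname{vol}(\Lambda_b)}\left(\frac{2\pi}{\sqrt{\gamma_b}}\right)^n\Theta^1_{\Lambda_b^*}\!\left(e^{-\frac{4\pi}{\sqrt{\gamma_b}}}\right)-1\right).$$ Moreover, let $\Lambda_e\subseteq\Lambda_b$ be a sublattice (of full rank $n$) and $\gamma_e>0$. The eavesdropper's correct decoding probability expression $P_{c,e}$ in the Rayleigh fading wiretap channel with lattice coset coding (as defined in the context) satisfies $$P_{c,e}\leq \frac{\operatorname{vol}(\Lambda_b)}{\operatorname{vol}(\Lambda_e)}\left(\frac{\pi}{\sqrt{6}}\right)^{n}\Theta_{\Lambda_e^*}^{1}\!\left(e^{-\frac{2\sqrt{2}\,\pi}{\sqrt{3\gamma_e}}}\right).$$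
   Context: A lattice $\Lambda\subseteq\mathbb{R}^n$ is the $\mathbb{Z}$-span of a basis of $\mathbb{R}^n$; $\operatorname{vol}(\Lambda)=|\det B|$ for any generator matrix $B$ (rows forming a basis of $\Lambda$); $\Lambda^*=\{y\in\mathbb{R}^n: x\cdot y\in\mathbb{Z}\text{ for all }x\in\Lambda\}$ is the dual lattice. The $\ell^1$-norm theta function is $\Theta^1_\Lambda(q)=\sum_{x\in\Lambda}q^{\|x\|_1}$ for real $0\le q<1$, where $\|x\|_1=\sum_{i=1}^n|x_i|$. Channel: the transmitted codeword $x$ lies in a finite subset $\mathcal{S}$ of the lattice $\Lambda_b$, and B receives $r=\operatorname{diag}(\alpha_1,\dots,\alpha_n)x+w$, where $\alpha_1,\dots,\alpha_n$ are independent Rayleigh variables with parameter $\sigma_{h,b}>0$, and $w$ is Gaussian noise with independent $N(0,\sigma_b^2)$ coordinates, independent of the $\alpha_i$; $x$ is independent of the fading and of the noise. Put $\gamma_b=\sigma_{h,b}^2/\sigma_b^2$. B knows the $\alpha_i$ (perfect channel state information) and decodes to a point $y$ of the signal set minimizing $\|r-\operatorname{diag}(\alpha_1,\dots,\alpha_n)y\|_2$. In lattice coding an error occurs when the decoded point differs from $x$. In lattice coset coding messages are identified with elements of $\Lambda_b/\Lambda_e$ for a sublattice $\Lambda_e\subseteq\Lambda_b$, and an error occurs when the decoded point is in a different coset modulo $\Lambda_e$ than $x$. $P_{e,b}$ is the probability of error. The following classical bound (Boutros et al.) is taken as known: $$P_{e,b}\le\frac12\sum_{x\in\Lambda_b\setminus\{0\}}\prod_{i=1}^n\frac{1}{1+\frac{\gamma_b}{4}x_i^2}.$$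 The eavesdropper's correct decoding probability is taken to be the expression of Belfiore and Oggier, $$P_{c,e}=\left(\frac{\gamma_e}{4}\right)^{n/2}\operatorname{vol}(\Lambda_b)\sum_{x\in\Lambda_e}\prod_{i=1}^n\frac{1}{(1+\gamma_e x_i^2)^{3/2}},$$ where $\gamma_e=\sigma_{h,e}^2/\sigma_e^2>0$ is the eavesdropper's average signal-to-noise ratio. *)

(* Defs.v *)
From HB Require Import structures.
From mathcomp Require Import all_boot all_order all_algebra.
From mathcomp Require Import all_classical all_reals all_analysis.

Set Implicit Arguments.
Unset Strict Implicit.
Unset Printing Implicit Defensive.

Import Order.TTheory GRing.Theory Num.Theory.
Import numFieldNormedType.Exports.

Local Open Scope classical_set_scope.
Local Open Scope ring_scope.

Section Lattices.
Context {R : realType} {n : nat}.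
Implicit Types (L : set 'rV[R]_n) (B : 'M[R]_n) (x y v : 'rV[R]_n).

Definition generates B L : Prop :=
  B \in unitmx /\
  L = [set x | exists z : 'rV[int]_n, x = map_mx intr z *m B].

Definition is_lattice L : Prop := exists B, generates B L.

(* The generator matrix is selected by choice; [volE] below shows that the
   value does not depend on it.  Junk when [L] is not a lattice. *)
Definition vol L : R := `| \det (xget 1%:M [set B | generates B L]) |.

Definition dotp x y : R := \sum_i x ord0 i * y ord0 i.

Definition dual L : set 'rV[R]_n :=
  [set y | forall x, L x -> dotp x y \is a Num.int].

Definition norm1 x : R := \sum_i `|x ord0 i|.

Definition norm2 x : R := Num.sqrt (\sum_i x ord0 i ^+ 2).

(* [esum] is the unordered sum of nonnegative terms, with values in [0, +oo]. *)
Definition theta1 L (q : R) : \bar R := \esum_(x in L) (q `^ norm1 x)%:E.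

Lemma generates_det B B' L :
  generates B L -> generates B' L -> `| \det B | = `| \det B' |.
Proof.
have factor C C' : generates C L -> generates C' L ->
    exists U : 'M[int]_n, C = map_mx intr U *m C'.
  move=> [_ LE] [_ LE'].
  have rowP i : exists z : 'rV[int]_n, row i C = map_mx intr z *m C'.
    suff : L (row i C) by rewrite LE'.
    by rewrite LE; exists (delta_mx 0 i); rewrite map_delta_mx -rowE.
  have [f fP] := choice rowP.
  exists (\matrix_i f i); apply/row_matrixP => i.
  by rewrite fP row_mul -map_row rowK.
move=> gB gB'.
have [U BU] := factor _ _ gB gB'; have [V BV] := factor _ _ gB' gB.
have detB0 : \det B != 0 by rewrite -unitfE -unitmxE; exact: gB.1.
have eqB : \det B = (\det U * \det V)%:~R * \det B.
  by rewrite {1}BU {1}BV !det_mulmx !det_map_mx mulrA intrM.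
have UV1 : \det U * \det V = 1.
  apply/eqP; rewrite -(eqr_int R); apply/eqP/(mulIf detB0).
  by rewrite -eqB mul1r.
have detU1 : `|\det U| = 1.
  have /intUnitRing.unitzPl : \det V * \det U = 1 by rewrite mulrC.
  by case/orP => /eqP ->.
by rewrite BU det_mulmx det_map_mx normrM -intr_norm detU1 mul1r.
Qed.

Lemma volE B L : generates B L -> vol L = `| \det B |.
Proof.
rewrite /vol => gB; case: xgetP => [C _ gC|/(_ B)//].
exact: generates_det gC gB.
Qed.

End Lattices.

Definition snr {R : realType} (sigma_h sigma : R) : R :=
  sigma_h ^+ 2 / sigma ^+ 2.

Definition rayleigh_pdf {R : realType} (sigma x : R) : R :=
  if 0 <= x then x / sigma ^+ 2 * expR (- (x ^+ 2 / (2 * sigma ^+ 2))) else 0.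

Definition rayleigh_prob {R : realType} (sigma : R) (A : set R) : \bar R :=
  (\int[lebesgue_measure]_(x in A) (rayleigh_pdf sigma x)%:E)%E.

Section Channel.
Context {R : realType} {d : measure_display} {T : measurableType d}.
Variable P : probability T R.

(* In the applications every [F i] is a sigma-algebra, so that this is mutual
   independence of the sigma-algebras [F i]. *)
Definition mutual_independence {I : finType} (F : I -> set (set T)) : Prop :=
  forall (J : {set I}) (E : I -> set T),
    (forall i, i \in J -> F i (E i)) ->
    P (\bigcap_(i in [set` J]) E i) = (\prod_(i in J) P (E i))%E.

Definition received {n} (x : T -> 'rV[R]_n) (alpha w : 'I_n -> T -> R) (t : T) :
    'rV[R]_n :=
  x t *m diag_mx (\row_i alpha i t) + \row_i w i t.

(* The sigma-algebras of the codeword (a discrete random variable, hence the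
   preimages of all sets), of each fading coefficient, and of each noise
   coordinate. *)
Definition channel_sigma_algebras {n} (x : T -> 'rV[R]_n)
    (alpha w : 'I_n -> T -> R) (i : option ('I_n + 'I_n)) : set (set T) :=
  match i with
  | None => preimage_set_system setT x setT
  | Some (inl j) => preimage_set_system setT (alpha j) measurable
  | Some (inr j) => preimage_set_system setT (w j) measurable
  end.

(* The decoded point is only required to be some minimizer at every outcome:
   ties may be broken in any measurable way. *)
Record rayleigh_channel {n} (L : set 'rV[R]_n) (sigma_h sigma : R) := {
  signal_set : set 'rV[R]_n;
  codeword : T -> 'rV[R]_n;
  fading : 'I_n -> {RV P >-> R};
  noise : 'I_n -> {RV P >-> R};
  decoded : T -> 'rV[R]_n;
  signal_set_finite : finite_set signal_set;
  signal_set_sub : signal_set `<=` L;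
  codeword_signal : forall t, signal_set (codeword t);
  codeword_measurable : forall s, measurable (codeword @^-1` [set s]);
  fading_rayleigh : forall i A, measurable A ->
    distribution P (fading i) A = rayleigh_prob sigma_h A;
  noise_normal : forall i A, measurable A ->
    distribution P (noise i) A = normal_prob 0 sigma A;
  channel_independence :
    mutual_independence (channel_sigma_algebras codeword fading noise);
  decoded_signal : forall t, signal_set (decoded t);
  decoded_measurable : forall s, measurable (decoded @^-1` [set s]);
  decoded_min : forall t y, signal_set y ->
    let dist z := norm2 (received codeword fading noise t
                         - z *m diag_mx (\row_i fading i t)) in
    dist (decoded t) <= dist y
}.

End Channel.

Variant coding_scheme (R : realType) (n : nat) :=
  | LatticeCoding
  | CosetCoding of set 'rV[R]_n.
Arguments LatticeCoding {R n}.

Definition scheme_valid {R : realType} {n} (L : set 'rV[R]_n)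
    (c : coding_scheme R n) : Prop :=
  match c with
  | LatticeCoding => True
  | CosetCoding Le => is_lattice Le /\ Le `<=` L
  end.

Definition error_event {R : realType} {n d} {T : measurableType d}
    {P : probability T R} {L : set 'rV[R]_n} {sigma_h sigma : R}
    (C : rayleigh_channel P L sigma_h sigma) (c : coding_scheme R n) : set T :=
  match c with
  | LatticeCoding => [set t | decoded C t <> codeword C t]
  | CosetCoding Le => [set t | ~ Le (decoded C t - codeword C t)]
  end.

Definition error_prob {R : realType} {n d} {T : measurableType d}
    {P : probability T R} {L : set 'rV[R]_n} {sigma_h sigma : R}
    (C : rayleigh_channel P L sigma_h sigma) (c : coding_scheme R n) : \bar R :=
  P (error_event C c).

(* The classical union bound (Boutros et al.) for the Rayleigh fading channel,
   stated for all channels and both kinds of coding. *)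
Definition boutros_bound (R : realType) : Prop :=
  forall (n : nat) (L : set 'rV[R]_n) (sigma_h sigma : R)
    (d : measure_display) (T : measurableType d) (P : probability T R)
    (C : rayleigh_channel P L sigma_h sigma) (c : coding_scheme R n),
  is_lattice L -> 0 < sigma_h -> 0 < sigma -> scheme_valid L c ->
  (error_prob C c <= 2^-1%:E * \esum_(x in L `\ (0 : 'rV[R]_n)%R)
     (\prod_i (1 + snr sigma_h sigma / 4 * x ord0 i ^+ 2)^-1)%:E)%E.

(* Belfiore and Oggier's expression for the eavesdropper's probability of
   correct decoding. *)
Definition correct_prob_eve {R : realType} {n} (Lb Le : set 'rV[R]_n)
    (gamma : R) : \bar R :=
  (((gamma / 4) `^ (n%:R / 2) * vol Lb)%:E *
    \esum_(x in Le) (\prod_i ((1 + gamma * x ord0 i ^+ 2) `^ (3 / 2))^-1)%:E)%E.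

(* Main.v *)
(* Both bounds reduce to one half of the Poisson summation formula: the sum over
   a lattice L of the products of 1 / (1 + c x_i^2) is at most
   vol(L)^-1 (pi / sqrt c)^n times the theta series of the dual lattice at
   exp(-2 pi / sqrt c); for the eavesdropper, first use Bernoulli's inequality
   (1 + u)^(3/2) >= 1 + 3u/2.

   No integral is needed.  For a mesh h > 0 the Cauchy kernel at x is bounded by
   h times the Poisson kernel at 2 pi h x, that is, by the Riemann sum of mesh h
   of its Fourier integral.  If the dual of L is a sublattice of h Z^n, the
   product of these kernels is periodic with respect to the subgroup h^-1 Z^n of
   L, and summing its Fourier series over the finite quotient L / h^-1 Z^n kills
   every frequency outside the dual lattice, which is the claim.  A general
   lattice is approximated by such lattices: round the entries of a generator
   matrix of its dual to multiples of h, and let h tend to 0. *)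

Require Import Defs.
From HB Require Import structures.
From mathcomp Require Import all_boot all_order all_algebra.
From mathcomp Require Import all_classical all_reals all_analysis.
From mathcomp Require Import complex zify ring lra.

Set Implicit Arguments.
Unset Strict Implicit.
Unset Printing Implicit Defensive.

Import Order.TTheory GRing.Theory Num.Theory.
Import numFieldNormedType.Exports.

Local Open Scope classical_set_scope.
Local Open Scope ring_scope.

(** * Poisson kernels *)

Lemma le_of_is_derive_ge0 (R : realType) (f df : R -> R) (t : R) :
  (forall x, is_derive x (1:R) f (df x)) -> (forall x, 0 <= x -> 0 <= df x) ->
  0 <= t -> f 0 <= f t.
Proof.
move=> fdf df0 t0.
have fc : {within `[0, t], continuous f}.
  by apply: derivable_within_continuous => x _; have [] := fdf x.
have [c /[!in_itv]/= /andP[c0 _]] := MVT_segment t0 (fun x _ => fdf x) fc.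
by move=> E; rewrite -subr_ge0 E subr0 mulr_ge0// df0.
Qed.

Lemma sqr_sin_le (R : realType) (x : R) : sin x ^+ 2 <= x ^+ 2.
Proof.
suff H (t : R) : 0 <= t -> `|sin t| <= t.
  rewrite -[leLHS]real_normK ?num_real// -[leRHS]real_normK ?num_real//.
  rewrite lerXn2r ?nnegrE//; case: (leP 0 x) => [x0|x0].
    by rewrite (ger0_norm x0) H.
  have -> : `|sin x| = `|sin (- x)| by rewrite sinN normrN.
  by rewrite (ltr0_norm x0) H//; lra.
move=> t0; rewrite ler_norml -subr_ge0 opprK addrC -[_ <= t]subr_ge0.
apply/andP; split.
  have D y : is_derive y (1 : R) (fun x : R => x + sin x) (1 + cos y).
    exact: is_derive_eq.
  have := le_of_is_derive_ge0 D _ t0; rewrite sin0 addr0; apply => y _.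
  by rewrite -lerBlDl sub0r cos_geN1.
have D y : is_derive y (1 : R) (fun x : R => x - sin x) (1 - cos y).
  exact: is_derive_eq.
have := le_of_is_derive_ge0 D _ t0; rewrite sin0 subr0; apply => y _.
by rewrite subr_ge0 cos_le1.
Qed.

Lemma mulr2_le_sinh (R : realType) (t : R) : 0 <= t ->
  t *+ 2 <= expR t - expR (- t).
Proof.
move=> t0; pose f x : R := expR x - expR (- x) - x *+ 2.
have fE x : is_derive x (1:R) f (expR x + expR (- x) - 2).
  rewrite /f; apply: is_derive_eq.
  by rewrite !mulrN1 opprK -mulr_natr mul1r.
suff : f 0 <= f t by rewrite /f oppr0 subrr mul0rn subr0 subr_ge0.
apply: (le_of_is_derive_ge0 fE _ t0).
move=> x x0; have e0 := expR_gt0 x.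
rewrite -(pmulr_rge0 _ e0) expRN.
have -> : expR x * (expR x + (expR x)^-1 - 2) = (expR x - 1) ^+ 2.
  by field; rewrite gt_eqF.
exact: sqr_ge0.
Qed.

(** This is tanh (t / 2) <= t / 2 with denominators cleared. The difference of the two sides has
    derivative 1 - (1 + x) e^(-x), which is nonnegative because 1 + x <= e^x. *)
Lemma tanh_le (R : realType) (t : R) : 0 <= t ->
  2 * (1 - expR (- t)) <= t * (1 + expR (- t)).
Proof.
move=> t0; pose f x : R := x * (1 + expR (- x)) - 2 * (1 - expR (- x)).
have fE x : is_derive x (1:R) f (1 - expR (- x) * (1 + x)).
  rewrite /f; apply: is_derive_eq.
  rewrite /GRing.scale/=; ring.
suff : f 0 <= f t by rewrite /f mul0r oppr0 expR0 subrr mulr0 subrr subr_ge0.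
apply: (le_of_is_derive_ge0 fE _ t0).
move=> x x0; rewrite subr_ge0 expRN mulrC ler_pdivrMr ?expR_gt0// mul1r.
exact: expR_ge1Dx.
Qed.

(** Closed form of the Fourier series of r^|k| cos (k x) over all integers k, for 0 <= r < 1. *)
Definition poisson_kernel (R : realType) (r x : R) : R :=
  (1 - r ^+ 2) / (1 - 2 * r * cos x + r ^+ 2).

(** The denominator equals (1 - r)^2 + 2 r (1 - cos x). *)
Lemma poisson_kernel_den_gt0 (R : realType) (r x : R) : 0 <= r < 1 ->
  0 < 1 - 2 * r * cos x + r ^+ 2.
Proof.
move=> /andP[r0 r1]; have := mulr_ge0 r0 (_ : 0 <= 1 - cos x).
rewrite subr_ge0 cos_le1 => /(_ isT) H.
have : 0 < (1 - r) ^+ 2 by rewrite exprn_gt0// subr_gt0.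
nra.
Qed.

Lemma poisson_kernel_ge0 (R : realType) (r x : R) : 0 <= r < 1 ->
  0 <= poisson_kernel r x.
Proof.
move=> r01; rewrite divr_ge0 ?(ltW (poisson_kernel_den_gt0 _ _))//.
case/andP: r01 => r0 r1; nra.
Qed.

(* With r = expR (- t) this is the inequality s / (s^2 + u^2) <= sinh s cosh s
   / (sinh^2 s + sin^2 u), where t = 2 s: it follows from sin^2 u <= u^2,
   2 s <= sinh (2 s) and tanh s <= s. *)
Lemma cauchy_le_poisson_kernel (R : realType) (t u : R) : 0 < t ->
  2 * t / (t ^+ 2 + 4 * u ^+ 2) <= poisson_kernel (expR (- t)) (2 * u).
Proof.
move=> t0; set r := expR (- t).
have r0 : 0 < r by exact: expR_gt0.
have r1 : r < 1 by rewrite expR_lt1; lra.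
have r01 : 0 <= r < 1 by rewrite r1 ltW.
have h1 : t * 2 * r <= 1 - r ^+ 2.
  have := mulr2_le_sinh (ltW t0); rewrite -(ler_pM2r r0) mulrBl -expRD subrr.
  by rewrite expR0 -(mulr_natr t 2) -/r -expr2.
have h2 : 2 * (1 - r) <= t * (1 + r) by exact/tanh_le/ltW.
have h3 := sqr_sin_le u.
have c2 : cos (2 * u) = 1 - 2 * sin u ^+ 2.
  by rewrite mulrC mulr_natr cos_mulr2n cos2sin2 -mulr_natr; ring.
have D := poisson_kernel_den_gt0 (2 * u) r01.
rewrite /poisson_kernel c2 in D *.
have DE : 1 - 2 * r * (1 - 2 * sin u ^+ 2) + r ^+ 2
    = (1 - r) ^+ 2 + 4 * r * sin u ^+ 2 by ring.
rewrite DE in D *.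
have u0 : 0 <= u ^+ 2 by exact: sqr_ge0.
have s0 : 0 <= sin u ^+ 2 by exact: sqr_ge0.
rewrite ler_pdivrMr; last by nra.
rewrite mulrAC ler_pdivlMr//.
(* With denominators cleared, the claim splits in two: [k2] handles the terms without u, and [k3]
   followed by [k1] those with sin^2 u and u^2. *)
have k1 : 8 * t * r * u ^+ 2 <= 4 * (1 - r ^+ 2) * u ^+ 2 by nra.
have k2 : 2 * t * (1 - r) ^+ 2 <= t ^+ 2 * (1 - r ^+ 2).
  have -> : 2 * t * (1 - r) ^+ 2 = t * (1 - r) * (2 * (1 - r)) by ring.
  have -> : t ^+ 2 * (1 - r ^+ 2) = t * (1 - r) * (t * (1 + r)) by ring.
  by rewrite ler_wpM2l// mulr_ge0 ?subr_ge0// ltW.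
have k3 : t * r * sin u ^+ 2 <= t * r * u ^+ 2 by apply: ler_wpM2l => //; nra.
lra.
Qed.

(** * Characters of the circle and of finite cyclic groups *)

Definition cis (R : realType) (x : R) : R[i] := Complex (cos x) (sin x).

Lemma cis0 (R : realType) : cis (0 : R) = 1.
Proof. by rewrite /cis cos0 sin0. Qed.

Lemma cisD (R : realType) (x y : R) : cis (x + y) = cis x * cis y.
Proof.
by apply/eqP; rewrite eq_complex /= cosD sinD eqxx [sin x * _ + _]addrC eqxx.
Qed.

Lemma cis_sum (R : realType) (I : Type) (s : seq I) (P : pred I) (f : I -> R) :
  cis (\sum_(i <- s | P i) f i) = \prod_(i <- s | P i) cis (f i).
Proof. by apply: (big_morph _ (@cisD R) (cis0 R)). Qed.

Lemma cisX (R : realType) (x : R) k : cis (k%:R * x) = cis x ^+ k.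
Proof.
by rewrite mulr_natl -[k in LHS]card_ord -sumr_const cis_sum prodr_const
  card_ord.
Qed.

Lemma cis2pi (R : realType) : cis (2 * pi : R) = 1.
Proof. by rewrite /cis mulr_natl cos2pi sin2pi. Qed.

Lemma cis2pi_int (R : realType) (k : int) : cis (2 * pi * k%:~R : R) = 1.
Proof.
have H m : cis (2 * pi * m%:R : R) = 1 by rewrite mulrC cisX cis2pi expr1n.
case: k => m; first exact: H.
by rewrite NegzE -[LHS]mulr1 -[in LHS](H m.+1) -cisD mulrNz mulrN addNr cis0.
Qed.

Lemma cosD2pi_int (R : realType) (x : R) (k : int) :
  cos (2 * pi * (x + k%:~R)) = cos (2 * pi * x).
Proof.
by rewrite mulrDr; have := cisD (2 * pi * x) (2 * pi * k%:~R);
  rewrite cis2pi_int mulr1 => -[].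
Qed.

(** Remove the integer part: for the fractional part y, cos (2 pi y) = 1 - 2 sin^2 (pi y), and sin
    (pi y) > 0 unless y = 0. *)
Lemma cos2pi_eq1 (R : realType) (x : R) : cos (2 * pi * x) = 1 ->
  x \is a Num.int.
Proof.
have [k [y [-> y0 y1]]] : exists k : int, exists y : R,
    [/\ x = y + k%:~R, 0 <= y & y < 1].
  exists (Num.floor x), (x - (Num.floor x)%:~R); have := floor_itv x.
  by rewrite subrK intrD => /andP[? ?]; split=> //; lra.
rewrite cosD2pi_int => c1; suff -> : y = 0 by rewrite add0r intr_int.
apply/eqP; rewrite eq_le y0 andbT leNgt; apply/negP => yp.
have : 0 < sin (pi * y).
  by rewrite sin_gt0_pi// mulr_gt0 ?pi_gt0//= gtr_pMr ?pi_gt0.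
move: c1; rewrite -mulrA mulr_natl cos_mulr2n cos2sin2 -mulr_natr => c1 s0.
nra.
Qed.

(** Orthogonality of characters of Z / d: the sum is geometric with ratio a |d|-th root of unity,
    which is 1 exactly when d divides u. *)
Lemma sum_cis (R : realType) (d u : int) : d != 0 ->
  \sum_(v < `|d|%N) cis (2 * pi * (v%:R * (u%:~R / d%:~R)) : R) =
  if (d %| u)%Z then (`|d|%N)%:R else 0.
Proof.
move=> d0; have dR : (d%:~R : R) != 0 by rewrite intr_eq0.
have E v : cis (2 * pi * (v%:R * (u%:~R / d%:~R)) : R)
    = cis (2 * pi * (u%:~R / d%:~R)) ^+ v by rewrite mulrCA cisX.
under eq_bigr do rewrite E.
case: ifPn => [/dvdzP[w ->]|ndu].
  by rewrite intrM mulfK// cis2pi_int; under eq_bigr do rewrite expr1n;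
    rewrite sumr_const card_ord.
set z := cis _.
have z1 : z != 1.
  apply: contra ndu; rewrite eq_complex /= => /andP[/eqP c1 _].
  have /intrP[k kE] := cos2pi_eq1 c1.
  apply/dvdzP; exists k; apply/eqP; rewrite -(eqr_int R) intrM -kE.
  by rewrite divfK.
apply/eqP; rewrite -(mulrI_eq0 _ (_ : GRing.lreg (z - 1))); last first.
  by apply/lregP; rewrite subr_eq0.
rewrite -subrX1 -cisX subr_eq0; apply/eqP.
(* The modulus d may be negative; |d| u / d is the integer sg(d) u, so the ratio to the power |d| is
   1. *)
suff -> : (`|d|%N)%:R * (2 * pi * (u%:~R / d%:~R)) =
    2 * pi * (Num.sg d * u)%:~R :> R by exact: cis2pi_int.
rewrite mulrCA; congr (_ * _).
rewrite -[(`|d|%N)%:R]/((`|d|%N : int)%:~R) abszE normrEsg !intrM.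
by rewrite -mulrA [_%:~R * (_ / _)]mulrC divfK.
Qed.

(** * Truncated Fourier series of the Poisson kernel *)

Lemma sum_ord_sym (V : zmodType) (G : int -> V) T :
  \sum_(j < T.*2.+1) G (j%:Z - T%:Z) =
  G 0 + \sum_(m < T) (G m.+1%:Z + G (- m.+1%:Z)).
Proof.
elim: T => [|T IH]; first by rewrite big_ord1 big_ord0 !addr0.
rewrite [in RHS]big_ord_recr /= addrA -IH doubleS big_ord_recl big_ord_recr /=.
rewrite [LHS]addrC -addrA; congr (_ + _).
  by apply: eq_bigr => j _; congr G; rewrite /bump; lia.
by congr (G _ + G _); rewrite /bump; lia.
Qed.

(** The partial sum over frequencies |k| <= T, with k and -k paired. Being finite, it can be
    multiplied out and its sums exchanged freely. *)
Definition trunc_poisson_kernel (R : realType) T (r x : R) : R :=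
  1 + \sum_(m < T) 2 * r ^+ m.+1 * cos (m.+1%:R * x).

Lemma trunc_poisson_kernelE (R : realType) T (r x : R) :
  real_complex R (trunc_poisson_kernel T r x) =
  \sum_(j < T.*2.+1) real_complex R (r ^+ `|j%:Z - T%:Z|%N)
     * cis ((j%:Z - T%:Z)%:~R * x).
Proof.
rewrite (sum_ord_sym (fun k : int => real_complex R (r ^+ `|k|%N)
  * cis (k%:~R * x))).
rewrite /= mul0r cis0 mulr1 expr0 rmorphD rmorph1; congr (_ + _).
rewrite rmorph_sum; apply: eq_bigr => m _ /=.
rewrite -mulrDr -mulrA [2 * _]mulrC -mulrA rmorphM; congr (_ * _).
apply/eqP; rewrite eq_complex /= mulrNz mulNr cosN sinN subrr eqxx andbT.
by rewrite mulr_natr mulr2n.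
Qed.

Lemma cvg_trunc_poisson_kernel (R : realType) (r x : R) : 0 <= r < 1 ->
  trunc_poisson_kernel T r x @[T --> \oo] --> poisson_kernel r x.
Proof.
move=> r01; have /andP[r0 r1] := r01.
set D := 1 - 2 * r * cos x + r ^+ 2.
have D0 : 0 < D by exact: poisson_kernel_den_gt0.
(* Multiplying by the denominator telescopes the series, by the recurrence 2 cos x cos (k x) = cos
   ((k+1) x) + cos ((k-1) x). The remainder is then a bounded multiple of r^T. *)
have closed T : trunc_poisson_kernel T r x * D = 1 - r ^+ 2
    - 2 * r ^+ T.+1 * cos (T.+1%:R * x) + 2 * r ^+ T.+2 * cos (T%:R * x).
  elim: T => [|T IH].
    by rewrite /trunc_poisson_kernel big_ord0 mul1r mul0r cos0 /D; ring.
  have -> : trunc_poisson_kernel T.+1 r x = trunc_poisson_kernel T r x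
      + 2 * r ^+ T.+1 * cos (T.+1%:R * x).
    by rewrite /trunc_poisson_kernel big_ord_recr /= addrA.
  rewrite mulrDl IH.
  have c1 : cos (T.+2%:R * x) =
      cos (T.+1%:R * x) * cos x - sin (T.+1%:R * x) * sin x.
    by rewrite -cosD; congr cos; rewrite -[T.+2%:R]natr1; ring.
  have c2 : cos (T%:R * x) =
      cos (T.+1%:R * x) * cos x + sin (T.+1%:R * x) * sin x.
    by rewrite -cosB; congr cos; rewrite -[T.+1%:R]natr1; ring.
  by rewrite c1 c2 /D !exprS; ring.
have E T : trunc_poisson_kernel T r x = poisson_kernel r x
    + (r ^+ T * (2 * r * (r * cos (T%:R * x) - cos (T.+1%:R * x)) / D)).
  apply: (mulIf (lt0r_neq0 D0)); rewrite closed /poisson_kernel -/D !exprS.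
  by field; rewrite gt_eqF.
apply/subr_cvg0; apply/norm_cvg0P.
have B T : `|trunc_poisson_kernel T r x - poisson_kernel r x|
    <= r ^+ T * (4 * r / D).
  rewrite E addrAC subrr add0r normrM (ger0_norm (exprn_ge0 _ r0)).
  rewrite ler_wpM2l ?exprn_ge0// normrM.
  rewrite [`|D^-1|]ger0_norm ?invr_ge0 ?(ltW D0)//.
  rewrite ler_pM2r ?invr_gt0// normrM ger0_norm; last by lra.
  have := cos_max (T%:R * x); have := cos_max (T.+1%:R * x).
  rewrite !ler_norml => /andP[? ?] /andP[? ?].
  suff : `|r * cos (T%:R * x) - cos (T.+1%:R * x)| <= 2 by nra.
  by rewrite ler_norml; apply/andP; split; nra.
apply: (squeeze_cvgr (f := fun=> 0) (h := fun T => r ^+ T * (4 * r / D))).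
- by near=> T; rewrite normr_ge0 B.
- exact: cvg_cst.
rewrite -[X in _ --> X](mul0r (4 * r / D)).
apply: cvgMl; apply: cvg_expr; by rewrite ger0_norm.
Unshelve. all: by end_near. Qed.

(** * Summation over a quotient of Z^n *)

(** The index f runs over representatives of the product of the groups Z / d_j; the common bound K
    gives all coordinates one ordinal type, and a frequency is stored with offset T. After
    multiplying out and exchanging sums, each frequency vector carries a product of character sums
    over the cyclic factors, so only those trivial on every factor survive. *)
Lemma sum_prod_trunc_poisson_kernel (R : realType) n (d : 'I_n -> int)
    (M : 'M[int]_n) K T (r : R) :
  (forall j, d j != 0) -> (forall j, (`|d j| <= K)%N) ->
  \sum_(f in family (fun j => [pred v : 'I_K | v < `|d j|]%N))
     \prod_i trunc_poisson_kernel T r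
       (2 * pi * \sum_j (f j)%:R / (d j)%:~R * (M j i)%:~R) =
  \sum_(m : {ffun 'I_n -> 'I_(T.*2.+1)}
        | [forall j, (d j %| \sum_i M j i * ((m i)%:Z - T%:Z))%Z])
     (\prod_j `|d j|)%:R * r ^+ (\sum_i `|(m i)%:Z - T%:Z|)%N.
Proof.
move=> d0 dK; apply: (@complexI R).
rewrite !rmorph_sum /=.
under eq_bigr => f _.
  rewrite rmorph_prod /=; under eq_bigr do rewrite trunc_poisson_kernelE.
  rewrite bigA_distr_bigA; over.
rewrite exchange_big [RHS]big_mkcond /=; apply: eq_bigr => m _.
pose u j : int := \sum_i M j i * ((m i)%:Z - T%:Z).
pose t (j : 'I_n) (v : 'I_K) : R := 2 * pi * (v%:R * ((u j)%:~R / (d j)%:~R)).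
transitivity ((real_complex R (r ^+ (\sum_i `|(m i)%:Z - T%:Z|)%N)) *
  \sum_(f in family (fun j => [pred v : 'I_K | v < `|d j|]%N))
    \prod_j cis (t j (f j))).
  rewrite mulr_sumr; apply: eq_bigr => f _; rewrite big_split /=.
  congr (_ * _); first by rewrite -rmorph_prod -expr_sum.
  rewrite -!cis_sum; congr cis.
  under eq_bigr do rewrite !mulr_sumr.
  rewrite exchange_big; apply: eq_bigr => j _ /=.
  rewrite /t /u rmorph_sum !mulr_suml !mulr_sumr; apply: eq_bigr => i _.
  by rewrite /= intrM; ring.
rewrite -(bigA_distr_big_dep (fun j => [pred v : 'I_K | v < `|d j|]%N)
  (fun j v => cis (t j v))).
have tE j : \sum_(v < K | (v < `|d j|)%N) cis (t j v) =
    if (d j %| u j)%Z then (`|d j|%N)%:R else 0.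
  rewrite -(sum_cis R (u j) (d0 j)).
  by rewrite (big_ord_widen _ (fun v => cis (2 * pi * (v%:R * _))) (dK j)).
rewrite [X in _ * X](eq_bigr (fun j =>
    if (d j %| u j)%Z then (`|d j|%N)%:R else 0 : R[i]));
  last by move=> j _; apply: etrans (tE j); exact: eq_bigl.
case: ifPn => [/forallP du|/forallPn[j ndu]]; last first.
  by rewrite [X in _ * X](bigD1 j)//= ifN// mul0r mulr0.
rewrite [X in _ * X](eq_bigr (fun j => (`|d j|%N)%:R)); last first.
  by move=> j _; rewrite ifT// du.
by rewrite rmorphM mulrC -natr_prod rmorph_nat.
Qed.

Lemma cvg_bigsum (R : realType) (T I : Type) (F : set_system T) (s : seq I)
    (P : pred I) (f : I -> T -> R) (a : I -> R) : Filter F ->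
  (forall i, P i -> f i x @[x --> F] --> a i) ->
  \sum_(i <- s | P i) f i x @[x --> F] --> \sum_(i <- s | P i) a i.
Proof. by move=> FF fa; apply: cvg_big => //; exact: add_continuous. Qed.

Lemma cvg_bigprod (R : realType) (T I : Type) (F : set_system T) (s : seq I)
    (P : pred I) (f : I -> T -> R) (a : I -> R) : Filter F ->
  (forall i, P i -> f i x @[x --> F] --> a i) ->
  \prod_(i <- s | P i) f i x @[x --> F] --> \prod_(i <- s | P i) a i.
Proof. by move=> FF fa; apply: cvg_big => //; exact: mul_continuous. Qed.

Lemma unitmx_int_absz n (M : 'M[int]_n) : M \in unitmx -> `|\det M|%N = 1%N.
Proof.
move=> uM; have /intUnitRing.unitzPl : \det (invmx M) * \det M = 1.
  by rewrite -det_mulmx mulVmx// det1.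
by case/orP => /eqP ->.
Qed.

Lemma ler_sum_uniq_map (R : numDomainType) (I : eqType) (J : finType)
    (s : seq I) (phi : I -> J) (Q : pred J) (f : J -> R) :
  uniq s -> {in s &, injective phi} -> (forall i, i \in s -> Q (phi i)) ->
  (forall j, 0 <= f j) ->
  \sum_(i <- s) f (phi i) <= \sum_(j | Q j) f j.
Proof.
move=> us iphi Qphi f0; rewrite -(big_map phi xpredT f).
rewrite big_uniq ?map_inj_in_uniq//= [leLHS]big_mkcond [leRHS]big_mkcond.
apply: ler_sum => j _; case: ifPn => [/mapP[i si ->]|_]; first by rewrite Qphi.
by case: ifP.
Qed.

(* The left-hand side is a sum over part of the quotient Z^n / Z^n A.  By the
   Smith normal form A = L D Q, this quotient is a product of cyclic groups
   Z / d_j, over which the Fourier series of the Poisson kernels is summed. *)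
Lemma sum_prod_poisson_kernel_le (R : realType) n (A : 'M[int]_n) (r S : R)
    (F : seq 'rV[int]_n) :
  \det A != 0 -> 0 <= r < 1 -> uniq F ->
  (forall z z' u, z \in F -> z' \in F -> z - z' = u *m A -> z = z') ->
  (forall X : seq 'rV[int]_n, uniq X ->
    (forall m, m \in X -> exists p, m = p *m A^T) ->
    \sum_(m <- X) r ^+ (\sum_i `|m ord0 i|)%N <= S) ->
  \sum_(z <- F) \prod_i poisson_kernel r
     (2 * pi * (map_mx intr z *m invmx (map_mx intr A)) ord0 i)
    <= (`|\det A|%N)%:R * S.
Proof.
move=> A0 r01 uF injF HS; have /andP[r0 _] := r01.
have [L uL [Q uQ [s _ AE]]] := int_Smith_normal_form A.
pose d (j : 'I_n) := s`_j; pose D : 'M[int]_n := diag_mx (\row_j d j).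
have {}AE : A = L *m D *m Q.
  rewrite AE; congr (_ *m _ *m _); apply/matrixP => i j; rewrite !mxE.
  by [].
have detD : \det D = \prod_j d j.
  by rewrite det_diag; apply: eq_bigr => j _; rewrite mxE.
have absA : `|\det A|%N = (\prod_j `|d j|)%N.
  rewrite AE !det_mulmx !abszM (unitmx_int_absz uL) (unitmx_int_absz uQ).
  rewrite mul1n muln1 detD.
  exact: (big_morph absz abszM).
have d0 j : d j != 0.
  by have := A0; rewrite -absz_eq0 absA; apply: contraNneq => dj;
    rewrite (bigD1 j)//= dj.
pose K := (\sum_j `|d j|)%N.+1.
have dK j : (`|d j| <= K)%N.
  by rewrite leqW// (bigD1 j)//= leq_addr.
(* In the coordinates z Q^-1, reduction modulo Z^n A becomes reduction of the j-th coordinate modulo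
   d_j; [phi] takes the residues. *)
pose w (z : 'rV[int]_n) j : int := (z *m invmx Q) ord0 j.
pose phi z : {ffun 'I_n -> 'I_K} := [ffun j => inord `|(w z j %% d j)%Z|%N].
have phiE z j : (phi z j : nat)%:Z = (w z j %% d j)%Z.
  have m0 := modz_ge0 (w z j) (d0 j); have ml := ltz_mod (w z j) (d0 j).
  rewrite ffunE inordK; first by rewrite gez0_abs.
  by rewrite -ltz_nat gez0_abs// (lt_le_trans ml)// -abszE lez_nat dK.
pose Li := invmx L.
pose x (f : {ffun 'I_n -> 'I_K}) i : R :=
  \sum_j (f j)%:R / (d j)%:~R * (Li j i)%:~R.
have kE z i : poisson_kernel r
     (2 * pi * (map_mx intr z *m invmx (map_mx intr A)) ord0 i) =
    poisson_kernel r (2 * pi * x (phi z) i).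
  (* Here z A^-1 = (w / d) L^-1. Dividing each w_j by d_j with remainder, the quotients contribute
     an integer, which the periodic kernel ignores. *)
  have -> : (map_mx intr z *m invmx (map_mx intr A)) ord0 i =
      x (phi z) i + (\sum_j (w z j %/ d j)%Z * Li j i)%:~R.
    pose y : 'rV[R]_n :=
      (\row_j ((w z j)%:~R / (d j)%:~R)) *m map_mx intr Li.
    have AR : map_mx intr A \in @unitmx R n.
      by rewrite unitmxE det_map_mx unitfE intr_eq0.
    have yA : y *m map_mx intr A = map_mx intr z.
      rewrite /y AE !map_mxM !mulmxA -[_ *m _ *m map_mx _ L]mulmxA -map_mxM.
      rewrite mulVmx// map_mx1 mulmx1 map_diag_mx mul_mx_diag.
      rewrite (_ : \matrix_(i, j) _ = map_mx intr (z *m invmx Q)).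
        by rewrite -map_mxM mulmxKV.
      by apply/rowP => j; rewrite !mxE divfK ?intr_eq0 // /w mxE.
    rewrite -yA mulmxK// !mxE /x rmorph_sum -big_split /=.
    apply: eq_bigr => j _; rewrite !mxE intrM -mulrDl; congr (_ * _).
    rewrite {1}(divz_eq (w z j) (d j)) intrD intrM mulrDl mulfK ?intr_eq0//.
    by rewrite addrC -phiE.
  by rewrite /poisson_kernel cosD2pi_int.
under eq_bigr do under eq_bigr do rewrite kE.
pose V := family (fun j => [pred v : 'I_K | v < `|d j|]%N).
apply: (@le_trans _ _
  (\sum_(f in V) \prod_i poisson_kernel r (2 * pi * x f i))).
  apply: (ler_sum_uniq_map (phi := phi)
    (f := fun f => \prod_i poisson_kernel r (2 * pi * x f i))) => //.
  (* Equal residues put z - z' in Z^n A, which [injF] excludes for distinct points of F. *)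
  - move=> z z' zF z'F phizz'.
    pose q : 'rV[int]_n :=
      \row_j ((w z j %/ d j)%Z - (w z' j %/ d j)%Z) *m Li.
    apply: (injF z z' q) => //.
    rewrite AE !mulmxA -[_ *m Li *m L]mulmxA mulVmx// mulmx1 mul_mx_diag.
    rewrite -[LHS](mulmxKV uQ) mulmxBl; congr (_ *m _).
    apply/rowP => j; transitivity (w z j - w z' j).
      by rewrite /w !mxE.
    rewrite !mxE.
    have em : (w z j %% d j)%Z = (w z' j %% d j)%Z by rewrite -!phiE phizz'.
    have := divz_eq (w z j) (d j); have := divz_eq (w z' j) (d j).
    rewrite em mulrBl; set a := (w z j %/ d j)%Z; set b := (w z' j %/ d j)%Z.
    set c := (_ %% _)%Z => -> ->; by rewrite opprD addrACA subrr addr0.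
  - move=> z _; apply/familyP => j; rewrite inE -ltz_nat phiE.
    exact: ltz_mod.
  - by move=> f; apply: prodr_ge0 => i _; exact: poisson_kernel_ge0.
(* It suffices to bound the truncated sums uniformly in T. *)
have cv : \sum_(f in V) \prod_i trunc_poisson_kernel T r (2 * pi * x f i)
    @[T --> \oo] --> \sum_(f in V) \prod_i poisson_kernel r (2 * pi * x f i).
  apply: cvg_bigsum => f _; apply: cvg_bigprod => i _.
  exact: cvg_trunc_poisson_kernel.
apply: (cvgr_to_le cv); apply: nearW => T.
rewrite (sum_prod_trunc_poisson_kernel Li T r d0 dK) absA -mulr_sumr.
apply: ler_wpM2l; first exact: ler0n.
pose rho (m : {ffun 'I_n -> 'I_(T.*2.+1)}) : 'rV[int]_n :=
  \row_i ((m i)%:Z - T%:Z).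
have irho : injective rho.
  move=> m m' /rowP mm'; apply/ffunP => i; have := mm' i; rewrite !mxE.
  by move=> /addIr[] /val_inj.
pose c (m : {ffun 'I_n -> 'I_(T.*2.+1)}) :=
  [forall j, (d j %| \sum_i Li j i * ((m i)%:Z - T%:Z))%Z].
have := HS [seq rho m | m <- enum c]; rewrite map_inj_uniq// enum_uniq big_map.
rewrite big_enum /= => /(_ isT) H; apply: le_trans (H _).
  rewrite le_eqVlt; apply/orP; left; apply/eqP; apply: eq_bigr => m _.
  by congr (_ ^+ _); apply: eq_bigr => i _; rewrite mxE.
move=> m' /mapP[m]; rewrite mem_enum => /forallP cm ->.
have {}cm j : exists k : int, \sum_i Li j i * ((m i)%:Z - T%:Z) = k * d j.
  by have /dvdzP := cm j.
have [k uE] := choice cm.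
(* The surviving frequencies satisfy m (L^-1)^T = k D, hence m = k D L^T = k (Q^-1)^T A^T. *)
exists ((\row_j k j) *m (invmx Q)^T).
rewrite AE !trmx_mul !mulmxA -[_ *m _ *m Q^T]mulmxA -trmx_mul mulmxV// trmx1.
rewrite mulmx1 tr_diag_mx mul_mx_diag.
rewrite (_ : \matrix_(i, j) _ = rho m *m Li^T).
  by rewrite -mulmxA -trmx_mul mulmxV// trmx1 mulmx1.
apply/rowP => j; rewrite !mxE -uE; apply: eq_bigr => i _.
by rewrite !mxE mulrC.
Qed.

(** * Passage to arbitrary lattices *)

Lemma near_all_seq (T : Type) (F : set_system T) (I : eqType) (s : seq I)
    (Q : I -> T -> Prop) : Filter F ->
  (forall i, i \in s -> \forall x \near F, Q i x) ->
  \forall x \near F, forall i, i \in s -> Q i x.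
Proof.
move=> FF; elim: s => [|i s IH] H; first by apply: nearW.
have Hs : \forall x \near F, forall j, j \in s -> Q j x.
  by apply: IH => j js; apply: H; rewrite inE js orbT.
have Hi := H i (mem_head _ _); near=> x => j; rewrite inE => /predU1P[->|].
  by near: x.
by move: j; near: x.
Unshelve. all: by end_near. Qed.

Lemma cvg_det (R : realType) (T : Type) (F : set_system T) n
    (M : T -> 'M[R]_n) (C : 'M[R]_n) : Filter F ->
  (forall i j, M x i j @[x --> F] --> C i j) ->
  \det (M x) @[x --> F] --> \det C.
Proof.
move=> FF MC; rewrite /determinant; apply: cvg_bigsum => s _.
by apply: cvgM; [exact: cvg_cst|exact: cvg_bigprod].
Qed.

(** Once the determinant is nonzero, the inverse is the adjugate divided by it, and both are
    polynomial in the entries. *)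
Lemma cvg_invmx (R : realType) (T : Type) (F : set_system T) n
    (M : T -> 'M[R]_n) (C : 'M[R]_n) : Filter F -> C \in unitmx ->
  (forall i j, M x i j @[x --> F] --> C i j) ->
  forall i j, invmx (M x) i j @[x --> F] --> invmx C i j.
Proof.
move=> FF uC MC i j; have dMC := cvg_det FF MC.
have dC0 : \det C != 0 by rewrite -unitfE -unitmxE.
have nM : \forall x \near F, \det (M x) != 0.
  exact: (cvgr_neq0 _ dMC).
apply: (@cvg_trans _ ((\det (M x))^-1 * \adj (M x) i j @[x --> F])).
  apply: near_eq_cvg; near=> x.
  rewrite /invmx unitmxE unitfE ifT ?mxE//; near: x; exact: nM.
rewrite /invmx uC mxE; apply: cvgM; first exact: cvgV.
rewrite !mxE; under eq_cvg do rewrite mxE.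
rewrite /cofactor; apply: cvgM; first exact: cvg_cst.
apply: cvg_det => k l; rewrite !mxE; under eq_cvg do rewrite !mxE.
exact: MC.
Unshelve. all: by end_near. Qed.

Lemma norm1_mulmx_le (R : realType) n (v : 'rV[R]_n) (G : 'M[R]_n) :
  norm1 (v *m G) <= norm1 v * \sum_i \sum_j `|G i j|.
Proof.
rewrite /norm1 mulr_suml.
apply: (@le_trans _ _ (\sum_j \sum_i `|v ord0 i| * `|G i j|)).
  apply: ler_sum => j _; rewrite mxE; apply: le_trans (ler_norm_sum _ _ _) _.
  by apply: ler_sum => i _; rewrite normrM.
rewrite exchange_big; apply: ler_sum => i _; rewrite -mulr_sumr.
apply: ler_wpM2l => //=; rewrite [leRHS](bigD1 i)//= lerDl.
by apply: sumr_ge0 => k _; apply: sumr_ge0.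
Qed.

Lemma norm1B (R : realType) n (u v : 'rV[R]_n) :
  norm1 u - norm1 v <= norm1 (u - v).
Proof.
rewrite /norm1 -sumrB; apply: ler_sum => i _; rewrite !mxE.
exact: lerB_dist.
Qed.

(** The Fourier transform at x of e^(-a |t|), for the characters e^(2 pi i x t). *)
Definition cauchy_kernel (R : realType) (a x : R) : R :=
  2 * a / (a ^+ 2 + 4 * (pi * x) ^+ 2).

Lemma cauchy_kernel_ge0 (R : realType) (a x : R) : 0 < a ->
  0 <= cauchy_kernel a x.
Proof.
move=> a0; apply: divr_ge0; first by rewrite mulr_ge0 // ltW.
by rewrite addr_ge0 ?sqr_ge0 // mulr_ge0 // sqr_ge0.
Qed.

(** The comparison of kernels with t = a h and u = pi x. The right side is the Riemann sum of mesh h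
    of the Fourier integral at x / h. *)
Lemma cauchy_kernel_le_poisson (R : realType) (a h x : R) : 0 < a -> 0 < h ->
  cauchy_kernel a (h^-1 * x) <=
    h * poisson_kernel (expR (- (a * h))) (2 * pi * x).
Proof.
move=> a0 h0; have := cauchy_le_poisson_kernel (pi * x) (mulr_gt0 a0 h0).
rewrite mulrA => /(ler_wpM2l (ltW h0)); apply: le_trans.
rewrite /cauchy_kernel le_eqVlt; apply/orP; left; apply/eqP.
move: (pi : R) => p; field.
rewrite (gt_eqF h0) gt_eqF//= ltr_wpDr ?exprn_gt0 ?mulr_gt0//.
by rewrite mulr_ge0// sqr_ge0.
Qed.

Lemma cvg_cauchy_kernel (R : realType) (T : Type) (F : set_system T)
    (f g : T -> R) (a x : R) : Filter F -> 0 < a ->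
  f t @[t --> F] --> a -> g t @[t --> F] --> x ->
  cauchy_kernel (f t) (g t) @[t --> F] --> cauchy_kernel a x.
Proof.
move=> FF a0 fa gx; apply: cvgM; first by apply: cvgM fa; exact: cvg_cst.
apply: cvgV.
  by rewrite gt_eqF// ltr_wpDr ?exprn_gt0// mulr_ge0// sqr_ge0.
under eq_cvg do rewrite !expr2; rewrite !expr2.
apply: cvgD; first exact: cvgM.
apply: cvgM; first exact: cvg_cst.
by apply: cvgM; (apply: cvgM; first exact: cvg_cst).
Qed.

(** The points z M^-1 form a lattice whose dual, the set of all p M^T, lies in h Z^n. The condition
    on F keeps its points distinct modulo h^-1 Z^n, and the factor h^n from the kernel comparison
    turns |det A| into |det M|. *)
Lemma sum_prod_cauchy_kernel_le_int (R : realType) n (A : 'M[int]_n)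
    (a h S : R) (F : seq 'rV[int]_n) (M := h *: map_mx intr A) :
  \det A != 0 -> 0 < a -> 0 < h -> uniq F ->
  (forall z z' u, z \in F -> z' \in F -> z - z' = u *m A -> z = z') ->
  (forall Y : seq 'rV[int]_n, uniq Y ->
    \sum_(p <- Y) expR (- (a * norm1 (map_mx intr p *m M^T))) <= S) ->
  \sum_(z <- F) \prod_i cauchy_kernel a ((map_mx intr z *m invmx M) ord0 i)
    <= `|\det M| * S.
Proof.
move=> A0 a0 h0 uF injF HS; set r := expR (- (a * h)).
have r01 : 0 <= r < 1 by rewrite expR_ge0 expR_lt1 oppr_lt0 mulr_gt0.
have AR : map_mx intr A \in @unitmx R n.
  by rewrite unitmxE det_map_mx unitfE intr_eq0.
have invM : invmx M = h^-1 *: invmx (map_mx intr A).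
  by rewrite /M invmxZ// unitmxZ// unitfE gt_eqF.
have -> : `|\det M| = h ^+ n * (`|\det A|%N)%:R.
  rewrite detZ normrM normrX gtr0_norm// det_map_mx -intr_norm.
  by congr (_ * _); rewrite -abszE.
apply: (@le_trans _ _ (\sum_(z <- F) h ^+ n * \prod_i poisson_kernel r
    (2 * pi * (map_mx intr z *m invmx (map_mx intr A)) ord0 i))).
  apply: ler_sum => z _; rewrite -[n in h ^+ n]card_ord -prodr_const -big_split.
  apply: ler_prod => i _; rewrite cauchy_kernel_ge0//= invM -scalemxAr mxE.
  exact: cauchy_kernel_le_poisson.
rewrite -mulr_sumr -mulrA; apply: ler_wpM2l; first by rewrite exprn_ge0// ltW.
apply: sum_prod_poisson_kernel_le => // X uX imX.
(* Each frequency is traced back to an integer vector p; the value 0 outside X is a mere default. *)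
have exg m : exists p, m \in X -> m = p *m A^T.
  by case: (boolP (m \in X)) => [/imX[p ->]|_]; [exists p|exists 0].
have [g gE] := choice exg.
have uY : uniq [seq g m | m <- X].
  by rewrite map_inj_in_uniq// => m m' /gE + /gE + e => -> ->; rewrite e.
apply: le_trans (HS _ uY); rewrite big_map [leLHS]big_seq [leRHS]big_seq.
rewrite le_eqVlt; apply/orP; left; apply/eqP; apply: eq_bigr => m mX.
rewrite -expRM_natr; congr expR; rewrite mulNr -mulrA; congr (- (_ * _)).
rewrite /M linearZ/= map_trmx -scalemxAr -map_mxM -gE// /norm1.
rewrite natr_sum mulr_sumr; apply: eq_bigr => i _; rewrite !mxE normrM.
by rewrite (gtr0_norm h0) -intr_norm -abszE.
Qed.

(* The grid approximation M of C loses a factor 1 - e on the 1-norms, which is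
   absorbed by the gap between the rates a < b. *)
Lemma sum_prod_cauchy_kernel_lt (R : realType) n (C : 'M[R]_n) (a b S : R)
    (F : seq 'rV[int]_n) :
  C \in unitmx -> 0 < a -> a < b -> uniq F ->
  (forall Y : seq 'rV[int]_n, uniq Y ->
    \sum_(p <- Y) expR (- (a * norm1 (map_mx intr p *m C^T))) <= S) ->
  \sum_(z <- F) \prod_i cauchy_kernel b ((map_mx intr z *m invmx C) ord0 i)
    <= `|\det C| * S.
Proof.
move=> uC a0 ab uF HS; have b0 : 0 < b by exact: lt_trans ab.
pose h k : R := k.+1%:R^-1.
have h0 k : 0 < h k by rewrite invr_gt0 ltr0n.
(* Entries are rounded down to the grid of mesh 1 / (k + 1). *)
pose A k : 'M[int]_n := \matrix_(i, j) Num.floor (k.+1%:R * C i j).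
pose M k : 'M[R]_n := h k *: map_mx intr (A k).
have MC i j : M k i j @[k --> \oo] --> C i j.
  apply/subr_cvg0/norm_cvg0P.
  apply: (squeeze_cvgr (f := fun=> 0) (h := h)); last first.
  - exact: cvg_harmonic.
  - exact: cvg_cst.
  near=> k; rewrite normr_ge0 /= !mxE.
  have := floor_itv (k.+1%:R * C i j); set m := Num.floor _.
  rewrite intrD => /andP[m1 m2].
  have -> : h k * m%:~R - C i j = h k * (m%:~R - k.+1%:R * C i j).
    by rewrite mulrBr mulrA mulVf ?mul1r// pnatr_eq0.
  rewrite normrM (gtr0_norm (h0 k)) ler_piMr ?(ltW (h0 k))//.
  by rewrite ler_norml; apply/andP; split; lra.
have dM := cvg_det eventually_filter MC.
have iM := cvg_invmx eventually_filter uC MC.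
have dC0 : \det C != 0 by rewrite -unitfE -unitmxE.
(* The relative error: with v = p C^T, one has v - p M_k^T = v G_k, so the error is controlled
   uniformly in p. *)
pose G k : 'M[R]_n := invmx C^T *m (C - M k)^T.
have G0 : \sum_i \sum_j `|G k i j| @[k --> \oo] --> (0 : R).
  rewrite [X in _ --> X](_ : 0 = \sum_(i < n) \sum_(j < n) `|0 : R|);
    last first.
    by rewrite big1// => i _; rewrite big1// => j _; rewrite normr0.
  apply: cvg_bigsum => i _; apply: cvg_bigsum => j _.
  have H : \sum_l invmx C^T i l * (C j l - M k j l) @[k --> \oo] -->
      \sum_(l < n) invmx C^T i l * (0 : R).
    apply: cvg_bigsum => l _; apply: cvgM; first exact: cvg_cst.
    by rewrite -(subrr (C j l)); apply: cvgB; [exact: cvg_cst|exact: MC].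
  rewrite big1 in H; last by move=> l _; rewrite mulr0.
  apply: cvg_norm; rewrite (_ : (fun k => G k i j) =
    (fun k => \sum_l invmx C^T i l * (C j l - M k j l)))//.
  apply/funext => k; rewrite mxE; apply: eq_bigr => l _.
  by rewrite 3!mxE.
have near_det : \forall k \near \oo, \det (M k) != 0 by exact: (cvgr_neq0 _ dM).
have near_G : \forall k \near \oo, \sum_i \sum_j `|G k i j| < 1 - a / b.
  apply: (cvgr_lt _ G0); by rewrite subr_gt0 ltr_pdivrMr// mul1r.
have iMv (v : 'rV[R]_n) i :
    (v *m invmx (M k)) ord0 i @[k --> \oo] --> (v *m invmx C) ord0 i.
  rewrite [X in _ --> X]mxE (_ : (fun k => (v *m invmx (M k)) ord0 i) =
    (fun k => \sum_l v ord0 l * invmx (M k) l i)); last first.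
    by apply/funext => k; rewrite mxE.
  by apply: cvg_bigsum => l _; apply: cvgM; [exact: cvg_cst|exact: iM].
(* If z - z' = u A_k, then u = h_k (z - z') M_k^-1, whose entries tend to 0. An integral u then
   vanishes eventually, so the finite F stays injective in the quotient. *)
have near_inj : \forall k \near \oo, forall z, z \in F ->
    forall z', z' \in F -> forall i, i \in enum 'I_n ->
    `|h k * (map_mx intr (z - z') *m invmx (M k)) ord0 i| < 1.
  apply: near_all_seq => z _; apply: near_all_seq => z' _.
  apply: near_all_seq => i _.
  have H0 := cvgM (@cvg_harmonic R) (iMv (map_mx intr (z - z')) i).
  by apply: (cvgr_norm_lt _ (H0 _)); rewrite mul0r normr0.
have L : \sum_(z <- F) \prod_i
      cauchy_kernel b ((map_mx intr z *m invmx (M k)) ord0 i) @[k --> \oo]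
    --> \sum_(z <- F) \prod_i
      cauchy_kernel b ((map_mx intr z *m invmx C) ord0 i).
  apply: cvg_bigsum => z _; apply: cvg_bigprod => i _.
  by apply: cvg_cauchy_kernel => //; exact: cvg_cst.
have U : `|\det (M k)| * S @[k --> \oo] --> `|\det C| * S.
  by apply: cvgMl; exact: cvg_norm.
apply: (ler_cvg_to L U); near=> k.
have dMk : \det (M k) != 0 by near: k; exact: near_det.
have Gk : \sum_i \sum_j `|G k i j| < 1 - a / b by near: k; exact: near_G.
have dAk : \det (A k) != 0.
  apply: contraNneq dMk => dA.
  by rewrite detZ det_map_mx dA mulr0.
apply: sum_prod_cauchy_kernel_le_int => //.
- move=> z z' u zF z'F zz'; apply/eqP; rewrite -subr_eq0 zz'.
  suff -> : u = 0 by rewrite mul0mx.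
  apply/rowP => i.
  have AR : map_mx intr (A k) \in @unitmx R n.
    by rewrite unitmxE det_map_mx unitfE intr_eq0.
  have uE : h k *: (map_mx intr (z - z') *m invmx (M k)) = map_mx intr u.
    rewrite zz' map_mxM /M invmxZ ?unitmxZ// ?unitfE ?gt_eqF//.
    by rewrite -scalemxAr mulmxK// scalerA divff ?scale1r// gt_eqF.
  have inj_k : forall z, z \in F -> forall z', z' \in F ->
      forall i, i \in enum 'I_n ->
      `|h k * (map_mx intr (z - z') *m invmx (M k)) ord0 i| < 1.
    by near: k; exact: near_inj.
  have := inj_k z zF z' z'F i (mem_enum _ _).
  have /rowP/(_ i) := uE; rewrite mxE => ->; rewrite !mxE -intr_norm.
  rewrite (ltr_int R _ 1) => u1; apply/eqP; apply: contraTT u1.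
  by rewrite -normr_gt0 -leNgt gtz0_ge1.
move=> Y uY; apply: le_trans (HS _ uY); apply: ler_sum => p _.
rewrite ler_expR lerN2 -/(M k).
set v := map_mx intr p *m C^T.
have vE : v - map_mx intr p *m (M k)^T = v *m G k.
  by rewrite /G mulmxA mulmxK ?unitmx_tr// linearB /= mulmxBr.
(* The triangle inequality gives |p M_k^T| >= (a / b) |v| in the 1-norm, hence e^(-b |p M_k^T|) <=
   e^(-a |v|). *)
have := norm1B v (v - map_mx intr p *m (M k)^T).
rewrite opprB addrCA subrr addr0 vE => H.
have := norm1_mulmx_le v (G k) => H2.
have v0 : 0 <= norm1 v by apply: sumr_ge0.
have : norm1 v * (\sum_i \sum_j `|G k i j|) <= norm1 v * (1 - a / b).
  by rewrite ler_wpM2l// ltW.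
move=> H3; have {}H : norm1 v * (a / b) <= norm1 (map_mx intr p *m (M k)^T).
  by lra.
move: H; rewrite mulrA ler_pdivrMr// => H; by rewrite mulrC (mulrC b).
Unshelve. all: by end_near. Qed.

(** The bound for rates b > a does not depend on b, and the finite left side is continuous in the
    rate; let b = a + 1 / (k + 1) decrease to a. *)
Lemma sum_prod_cauchy_kernel_le (R : realType) n (C : 'M[R]_n) (a S : R)
    (F : seq 'rV[int]_n) :
  C \in unitmx -> 0 < a -> uniq F ->
  (forall Y : seq 'rV[int]_n, uniq Y ->
    \sum_(p <- Y) expR (- (a * norm1 (map_mx intr p *m C^T))) <= S) ->
  \sum_(z <- F) \prod_i cauchy_kernel a ((map_mx intr z *m invmx C) ord0 i)
    <= `|\det C| * S.
Proof.
move=> uC a0 uF HS.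
have L : \sum_(z <- F) \prod_i
      cauchy_kernel (a + k.+1%:R^-1) ((map_mx intr z *m invmx C) ord0 i)
      @[k --> \oo]
    --> \sum_(z <- F) \prod_i
      cauchy_kernel a ((map_mx intr z *m invmx C) ord0 i).
  apply: cvg_bigsum => z _; apply: cvg_bigprod => i _.
  apply: cvg_cauchy_kernel => //; last exact: cvg_cst.
  rewrite -[X in _ --> X]addr0; apply: cvgD; first exact: cvg_cst.
  exact: cvg_harmonic.
apply: (cvgr_to_le L); apply: nearW => k.
apply: sum_prod_cauchy_kernel_lt uF HS => //.
by rewrite ltrDl invr_gt0 ltr0n.
Qed.

(** * Unordered sums over a lattice *)

Lemma esum_le_seq (R : realType) (T : choiceType) (A : set T) (f : T -> R)
    (M : \bar R) :
  (forall s : seq T, uniq s -> (forall x, x \in s -> A x) ->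
    ((\sum_(x <- s) f x)%R%:E <= M)%E) ->
  (\esum_(x in A) (f x)%:E <= M)%E.
Proof.
move=> H; apply: ge_ereal_sup => _ [X [/finite_seqP[s ->] sA] <-].
have -> : [set` s] = [set` undup s].
  by apply/seteqP; split => x /=; rewrite mem_undup.
rewrite -fsbig_seq ?undup_uniq// sumEFin; apply: H; first exact: undup_uniq.
by move=> x; rewrite mem_undup; exact: sA.
Qed.

Lemma seq_le_esum (R : realType) (T : choiceType) (A : set T) (f : T -> R)
    (s : seq T) : uniq s -> (forall x, x \in s -> A x) ->
  ((\sum_(x <- s) f x)%R%:E <= \esum_(x in A) (f x)%:E)%E.
Proof.
move=> us sA; apply: esum_ge; exists [set` s].
  by split; [exact: finite_seq|exact: sA].
by rewrite -fsbig_seq// sumEFin.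
Qed.

(** The matrices cancel in the inner product, leaving the integer z p^T. Finite sums over p are
    thereby bounded by the theta series of the dual, whose terms are nonnegative. *)
Lemma dual_generates (R : realType) n (B : 'M[R]_n) (L : set 'rV[R]_n)
    (p : 'rV[int]_n) :
  generates B L -> dual L (map_mx intr p *m (invmx B)^T).
Proof.
move=> [uB ->] _ [z ->].
have -> : dotp (map_mx intr z *m B) (map_mx intr p *m (invmx B)^T)
    = ((z *m p^T) ord0 ord0)%:~R.
  transitivity ((map_mx intr z *m B
    *m (map_mx intr p *m (invmx B)^T)^T) ord0 ord0).
    by rewrite [RHS]mxE; apply: eq_bigr => i _; rewrite [X in _ = _ * X]mxE.
  rewrite trmx_mul trmxK !mulmxA mulmxK// map_trmx -map_mxM.
  by rewrite [LHS]mxE.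
exact: intr_int.
Qed.

Lemma esum_lattice_le (R : realType) n (L : set 'rV[R]_n) (c : R) :
  is_lattice L -> 0 < c ->
  (\esum_(x in L) (\prod_i (1 + c * x ord0 i ^+ 2)^-1)%:E <=
   ((vol L)^-1 * (pi / Num.sqrt c) ^+ n)%:E
     * theta1 (dual L) (expR (- (2 * pi / Num.sqrt c))))%E.
Proof.
move=> [B gB] c0; have [uB LE] := gB.
pose q := Num.sqrt c; have q0 : 0 < q by rewrite sqrtr_gt0.
have p0 := pi_gt0 R.
(* At this rate the Cauchy kernel is (q / pi) / (1 + c x^2). *)
pose a : R := 2 * pi / q; have a0 : 0 < a by rewrite divr_gt0// mulr_gt0.
have detB0 : 0 < `|\det B| by rewrite normr_gt0 -unitfE -unitmxE.
have k0 : 0 < (vol L)^-1 * (pi / q) ^+ n.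
  by rewrite (volE gB) mulr_gt0 ?invr_gt0// exprn_gt0// divr_gt0.
rewrite -/q -/a.
have thE : theta1 (dual L) (expR (- a)) =
    \esum_(x in dual L) (expR (- (a * norm1 x)))%:E.
  by apply: eq_esum => x _; rewrite -expRM mulNr.
have : (0 <= theta1 (dual L) (expR (- a)))%E.
  by rewrite thE; apply: esum_ge0 => x _; rewrite lee_fin expR_ge0.
(* A divergent theta series makes the right side +oo, as its coefficient is positive; nonnegativity
   excludes -oo. *)
case E : (theta1 _ _) => [S| |] // _; last by rewrite gt0_muley ?leey// lte_fin.
have HS (Y : seq 'rV[int]_n) : uniq Y ->
    \sum_(p <- Y) expR (- (a * norm1 (map_mx intr p *m (invmx B)^T))) <= S.
  move=> uY; rewrite -lee_fin -E thE.
  pose g (p : 'rV[int]_n) : 'rV[R]_n := map_mx intr p *m (invmx B)^T.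
  have ginj : injective g.
    move=> p p' /(congr1 (mulmx^~ (invmx (invmx B)^T))).
    rewrite /= !mulmxK ?unitmx_tr ?unitmx_inv// => /matrixP pp'.
    by apply/matrixP => i j; have := pp' i j; rewrite !mxE => /intr_inj.
  rewrite -(big_map g xpredT (fun x => expR (- (a * norm1 x)))).
  apply: seq_le_esum; first by rewrite map_inj_uniq.
  by move=> _ /mapP[p _ ->]; exact: dual_generates.
apply: esum_le_seq => s us sL.
have exz x : exists z : 'rV[int]_n, x \in s -> x = map_mx intr z *m B.
  case: (boolP (x \in s)) => [/sL|_]; last by exists 0.
  by rewrite LE => -[z ->]; exists z.
have [z zE] := choice exz.
have uz : uniq [seq z x | x <- s].
  by rewrite map_inj_in_uniq// => x y /zE + /zE + e => -> ->; rewrite e.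
(* With C = B^-1, the points z C^-1 are those of L and the p C^T lie in its dual. *)
have uC : invmx B \in unitmx by rewrite unitmx_inv.
have := sum_prod_cauchy_kernel_le uC a0 uz HS.
rewrite invmxK big_map det_inv normfV -(volE gB) => H.
rewrite lee_fin mulrAC mulrC; apply: le_trans (ler_wpM2l _ H); last first.
  by rewrite exprn_ge0// divr_ge0// ltW.
rewrite mulr_sumr le_eqVlt; apply/orP; left; apply/eqP.
rewrite big_seq [RHS]big_seq; apply: eq_bigr => x xs.
rewrite -[n in _ ^+ n]card_ord -prodr_const -big_split.
apply: eq_bigr => i _ /=.
rewrite -zE// /cauchy_kernel /a -(sqr_sqrtr (ltW c0)) -/q.
move: (pi : R) p0 => p p0; field.
rewrite !gt_eqF//.
- by rewrite ltr_wpDr// sqr_ge0.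
- by rewrite ltr_wpDr ?exprn_gt0 ?mulr_gt0// mulr_ge0 ?sqr_ge0// mulr_ge0//
    sqr_ge0.
Qed.

(** * The bounds for the legitimate receiver and the eavesdropper *)

Lemma bernoulli_powR32 (R : realType) (u : R) : 0 <= u ->
  1 + 3 / 2 * u <= (1 + u) `^ (3 / 2).
Proof.
move=> u0; have u1 : 0 <= 1 + u by lra.
rewrite powRrM powR12_sqrt ?powR_ge0// (powR_mulrn 3)//.
rewrite -[leLHS]ger0_norm; last by lra.
rewrite -sqrtr_sqr ler_sqrt ?exprn_ge0//.
(* After squaring, the two sides differ by 3/4 u^2 + u^3. *)
have : 0 <= u ^+ 2 by exact: sqr_ge0.
have : 0 <= u ^+ 3 by exact: exprn_ge0.
have -> : (1 + u) ^+ 3 = 1 + 3 * u + 3 * u ^+ 2 + u ^+ 3 by ring.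
have -> : (1 + 3 / 2 * u) ^+ 2 = 1 + 3 * u + 9 / 4 * u ^+ 2 by field.
lra.
Qed.

Theorem corollary1 (R : realType) (n : nat) (Lb : set 'rV[R]_n)
    (hLb : is_lattice Lb) :
  (boutros_bound R ->
   forall (sigma_h sigma : R) (d : measure_display) (T : measurableType d)
     (P : probability T R) (C : rayleigh_channel P Lb sigma_h sigma)
     (c : coding_scheme R n) (gamma_b : R),
   0 < sigma_h -> 0 < sigma -> scheme_valid Lb c ->
   gamma_b = snr sigma_h sigma ->
   (error_prob C c <=
    2^-1%:E * (((vol Lb)^-1 * (2 * pi / Num.sqrt gamma_b) ^+ n)%:E
                 * theta1 (dual Lb) (expR (- (4 * pi / Num.sqrt gamma_b)))
               - 1))%E)
  /\
  (forall (Le : set 'rV[R]_n) (gamma_e : R),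
   is_lattice Le -> Le `<=` Lb -> 0 < gamma_e ->
   (correct_prob_eve Lb Le gamma_e <=
    (vol Lb / vol Le * (pi / Num.sqrt 6) ^+ n)%:E
      * theta1 (dual Le)
          (expR (- (2 * Num.sqrt 2 * pi / Num.sqrt (3 * gamma_e)))))%E).
Proof.
split.
  move=> boutros sigma_h sigma d T P C c gamma_b sh0 s0 cv gE.
  have g0 : 0 < gamma_b by rewrite gE divr_gt0// exprn_gt0.
  have sg0 : 0 < Num.sqrt gamma_b by rewrite sqrtr_gt0.
  apply: le_trans (boutros _ _ _ _ _ _ _ C c hLb sh0 s0 cv) _.
  rewrite -gE; apply: lee_wpmul2l; first by rewrite lee_fin invr_ge0.
  have := esum_lattice_le hLb (divr_gt0 g0 (ltr0n R 4)).
  have -> : Num.sqrt (gamma_b / 4) = Num.sqrt gamma_b / 2.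
    rewrite sqrtrM ?ltW//; congr (_ * _); rewrite sqrtrV//; congr (_^-1).
    by rewrite (_ : 4 = 2 ^+ 2) ?sqrtr_sqr ?ger0_norm// -natrX.
  have -> : pi / (Num.sqrt gamma_b / 2) = 2 * pi / Num.sqrt gamma_b.
    by field; rewrite gt_eqF.
  have -> : 2 * pi / (Num.sqrt gamma_b / 2) = 4 * pi / Num.sqrt gamma_b.
    by field; rewrite gt_eqF.
  move=> H; rewrite leeBrDr//; apply: le_trans H.
  (* The full lattice sum is split at the origin, whose term is 1; this accounts for the -1 in the
     bound. *)
  have L0 : Lb `&` [set 0] = [set 0].
    apply/seteqP; split => [x []//|_ ->]; split => //.
    have [B [_ ->]] := hLb; exists 0.
    by rewrite map_mx0 mul0mx.
  rewrite (esumID [set 0] Lb) => [|x _]; last first.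
    by rewrite lee_fin prodr_ge0// => i _; rewrite invr_ge0 addr_ge0// mulr_ge0
      ?sqr_ge0// divr_ge0// ltW.
  rewrite L0 esum_set1 => [|]; last first.
    by rewrite lee_fin prodr_ge0// => i _; rewrite invr_ge0 addr_ge0// mulr_ge0
      ?sqr_ge0// divr_ge0// ltW.
  rewrite big1 => [|i _]; last by rewrite mxE expr0n mulr0 addr0 invr1.
  by rewrite addeC.
move=> Le g hLe sLe g0.
have c0 : 0 < 3 / 2 * g by rewrite mulr_gt0.
have g40 : 0 < Num.sqrt (g / 4) by rewrite sqrtr_gt0 divr_gt0.
(* This form cancels the prefactor (g / 4)^(n / 2) and leaves (pi / sqrt 6)^n; [cE'] rewrites the
   same root for the exponent of the theta series. *)
have cE : Num.sqrt (3 / 2 * g) = Num.sqrt 6 * Num.sqrt (g / 4).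
  by rewrite -sqrtrM//; congr Num.sqrt; field.
have q2 : 0 < Num.sqrt 2 :> R by rewrite sqrtr_gt0.
have q6 : 0 < Num.sqrt 6 :> R by rewrite sqrtr_gt0.
have cE' : Num.sqrt (3 / 2 * g) = Num.sqrt (3 * g) / Num.sqrt 2.
  apply: (mulIf (lt0r_neq0 q2)); rewrite divfK ?gt_eqF// -sqrtrM ?ltW//.
  by congr Num.sqrt; field.
have expE : 2 * pi / Num.sqrt (3 / 2 * g) =
    2 * Num.sqrt 2 * pi / Num.sqrt (3 * g).
  rewrite cE'; field; rewrite !gt_eqF// ?sqrtr_gt0 ?mulr_gt0//.
rewrite /correct_prob_eve.
have vb0 : 0 <= vol Lb by exact: normr_ge0.
have k0 : 0 <= (g / 4) `^ (n%:R / 2) * vol Lb.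
  by rewrite mulr_ge0 ?powR_ge0.
apply: (@le_trans _ _ (((g / 4) `^ (n%:R / 2) * vol Lb)%:E *
  \esum_(x in Le) (\prod_i (1 + (3 / 2 * g) * x ord0 i ^+ 2)^-1)%:E)%E).
  apply: lee_wpmul2l; first by rewrite lee_fin.
  apply: le_esum => x _; rewrite lee_fin; apply: ler_prod => i _.
  have gx : 0 <= g * x ord0 i ^+ 2 by rewrite mulr_ge0 ?sqr_ge0// ltW.
  have dg : 0 < 1 + g * x ord0 i ^+ 2 by rewrite ltr_wpDr.
  rewrite invr_ge0 powR_ge0/= lef_pV2 ?posrE ?powR_gt0//.
    by rewrite -(mulrA (3 / 2)); exact: bernoulli_powR32.
  by rewrite -(mulrA (3 / 2)) ltr_wpDr// mulr_ge0.
apply: le_trans (lee_wpmul2l _ (esum_lattice_le hLe c0)) _.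
  by rewrite lee_fin.
rewrite muleA -EFinM expE.
rewrite [X in (X%:E * _ <= _)%E](_ : _ =
  vol Lb / vol Le * (pi / Num.sqrt 6) ^+ n)//.
rewrite [n%:R / 2]mulrC powRrM powR12_sqrt ?powR_mulrn ?(ltW g40)//; last first.
  by rewrite divr_ge0// ltW.
have -> : pi / Num.sqrt 6 = Num.sqrt (g / 4) * (pi / Num.sqrt (3 / 2 * g)).
  by rewrite cE; field; rewrite !gt_eqF.
move: (pi / Num.sqrt (3 / 2 * g)) => u; rewrite exprMn.
by move: (u ^+ n) (_ ^+ n) (vol Le)^-1 => v w t; ring.
Qed.
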